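(* Let $\underline{r}$ and $\underline{s}$ be two valid rank lists for the same linear neural network (i.e., $r_{j\sim j}=s_{j\sim j}=d_j$ for all $j\in[0,L]$). Let $W\in\mathbb{R}^{d_L\times d_0}$ be a matrix whose rank satisfies $\operatorname{rk}W=r_{L\sim0}=s_{L\sim0}$, and let $S_{\underline{r}}$ and $S_{\underline{s}}$ be the strata with rank lists $\underline{r}$ and $\underline{s}$ in the rank stratification of the fiber $\mu^{-1}(W)$ (both strata are nonempty). Then the following statements are equivalent. A. $S_{\underline{r}}\subseteq\bar S_{\underline{s}}$. B. $S_{\underline{r}}\cap\bar S_{\underline{s}}\ne\emptyset$. C. $\underline{r}\le\underline{s}$. D. There exists a (finite, possibly empty) sequence of rank-one abstract connecting and swapping moves that proceed from $\underline{r}$ to $\underline{s}$, with all the intermediate rank lists being valid.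
   Context: Fix integers $L\ge1$ and $d_0,\ldots,d_L\ge1$. The weight space is $\mathbb{R}^{d_\theta}=\mathbb{R}^{d_L\times d_{L-1}}\times\cdots\times\mathbb{R}^{d_1\times d_0}$; a weight vector is $\theta=(W_L,\ldots,W_1)$ with $W_j\in\mathbb{R}^{d_j\times d_{j-1}}$. $\mu(\theta)=W_LW_{L-1}\cdots W_1$ and $\mu^{-1}(W)=\{\theta:\mu(\theta)=W\}$. For $L\ge k\ge i\ge0$, $W_{k\sim i}=W_kW_{k-1}\cdots W_{i+1}$, with $W_{k\sim k}=I_{d_k\times d_k}$. The rank list of $\theta$ is the family $\langle\operatorname{rk}W_{k\sim i}\rangle_{L\ge k\ge i\ge0}$. A rank list $\underline{r}=\langle r_{k\sim i}\rangle_{L\ge k\ge i\ge0}$ is valid if it is the rank list of some weight vector $\theta\in\mathbb{R}^{d_\theta}$. $S_{\underline{r}}=\{\theta\in\mu^{-1}(W):\text{the rank list of }\theta\text{ is }\underline{r}\}$. $\bar S$ is the closure of $S$ in $\mathbb{R}^{d_\theta}$. $\underline{r}\le\underline{s}$ means $r_{k\sim i}\le s_{k\sim i}$ for all $L\ge k\ge i\ge0$. The interval multiplicities of a rank list $\underline{r}$ are $\omega_{ki}=r_{k\sim i}-r_{k\sim i-1}-r_{k+1\sim i}+r_{k+1\sim i-1}$ for $L\ge k\ge i\ge0$, with the convention $r_{L+1\sim x}=0=r_{y\sim-1}$; conversely $r_{k\sim i}=\sum_{t=k}^L\sum_{s=0}^i\omega_{ts}$. A rank-$c$ abstract connecting move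 takes a valid rank list and an index tuple $(l,k,i,h)$ with $L\ge l\ge k+1=i>h\ge0$ and yields the rank list obtained by increasing $\omega_{lh}$ by $c$ and decreasing $\omega_{li}$ and $\omega_{kh}$ by $c$ (all other interval multiplicities unchanged). A rank-$c$ abstract swapping move takes a valid rank list and an index tuple $(l,k,i,h)$ with $L\ge l>k\ge i>h\ge0$ and yields the rank list obtained by increasing $\omega_{lh}$ and $\omega_{ki}$ by $c$ and decreasing $\omega_{li}$ and $\omega_{kh}$ by $c$. Both kinds of move require $\omega_{li}\ge c$ and $\omega_{kh}\ge c$ before the move. Rank-one means $c=1$. *)

(* Defs.v *)
From HB Require Import structures.
From mathcomp Require Export all_boot all_order all_algebra.
From mathcomp Require Export all_classical all_reals all_analysis.

Set Implicit Arguments.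
Unset Strict Implicit.
Unset Printing Implicit Defensive.
Import Order.TTheory GRing.Theory Num.Theory.
Import numFieldNormedType.Exports.

Local Open Scope classical_set_scope.
Local Open Scope ring_scope.

(* The component of theta at j : 'I_L is the weight matrix W_{j+1}, of size
   d_{j+1} x d_j.  Only d 0, ..., d L are relevant. *)
Definition weight_space (R : realType) (L : nat) (d : nat -> nat) :=
  prod_topology (fun j : 'I_L => 'M[R]_(d j.+1, d j)).

HB.instance Definition _ (R : realType) (L : nat) (d : nat -> nat) :=
  Uniform.copy (weight_space R L d)
    (prod_topology (fun j : 'I_L => 'M[R]_(d j.+1, d j))).

Section Network.
Variables (R : realType) (L : nat) (d : nat -> nat).
Implicit Types (theta : weight_space R L d) (r s : nat -> nat -> nat).

(* W_{j+1}, with junk value 0 when j >= L. *)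
Definition layer theta (j : nat) : 'M[R]_(d j.+1, d j) :=
  match @idP (j < L)%N with
  | ReflectT jL => theta (Ordinal jL)
  | ReflectF _ => 0
  end.

(* W_{k~i} = W_k *m ... *m W_{i+1}, meaningful for i <= k <= L only.
   When i = k, the term pid_mx (d i) : 'M_(d k, d i) is the identity matrix;
   it is used because the types 'M_(d k, d i) and 'M_(d k) differ. *)
Fixpoint subprod theta (k i : nat) : 'M[R]_(d k, d i) :=
  match k with
  | 0 => pid_mx (d i)
  | k'.+1 => if i == k'.+1 then pid_mx (d i)
             else layer theta k' *m subprod theta k' i
  end.

Lemma subprod_id theta k : subprod theta k k = 1%:M.
Proof. by case: k => [|k] /=; rewrite ?eqxx pid_mx_1. Qed.

Lemma subprodS theta k i : (i <= k)%N ->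
  subprod theta k.+1 i = layer theta k *m subprod theta k i.
Proof. by move=> ik /=; case: eqP ik => // ->; rewrite ltnn. Qed.

Definition mu theta : 'M[R]_(d L, d 0) := subprod theta L 0.

Definition fiber (W : 'M[R]_(d L, d 0)) : set (weight_space R L d) :=
  [set theta | mu theta = W].

(* A rank list is encoded by a function r with r k i = r_{k~i}; its values
   outside the triangle i <= k <= L are irrelevant. *)
Definition has_rank_list theta r : Prop :=
  forall k i, (i <= k)%N -> (k <= L)%N -> \rank (subprod theta k i) = r k i.

Definition valid_rank_list r : Prop := exists theta, has_rank_list theta r.

Lemma valid_rank_list_diag r j :
  valid_rank_list r -> (j <= L)%N -> r j j = d j.
Proof. by move=> [theta rP] jL; rewrite -rP// subprod_id mxrank1. Qed.

Definition stratum (W : 'M[R]_(d L, d 0)) r : set (weight_space R L d) :=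
  [set theta | fiber W theta /\ has_rank_list theta r].

End Network.

Arguments mu {R} L d theta.
Arguments fiber {R} L d W.
Arguments stratum {R} L d W r.

Section AbstractMoves.
Variable L : nat.
Implicit Types r s : nat -> nat -> nat.

Definition eq_rank_list r s : Prop :=
  forall k i, (i <= k)%N -> (k <= L)%N -> r k i = s k i.

Definition le_rank_list r s : Prop :=
  forall k i, (i <= k)%N -> (k <= L)%N -> (r k i <= s k i)%N.

(* The entry r_{k~i-1} of the rank list, which is 0 if i = 0. *)
Definition rk_pred r (k i : nat) : int :=
  if i is i'.+1 then (r k i')%:Z else 0.

(* The interval multiplicity omega_{ki}, with r_{L+1~x} = 0 = r_{y~-1}. *)
Definition omega r (k i : nat) : int :=
  (r k i)%:Z - rk_pred r k i
  - (if (k < L)%N then (r k.+1 i)%:Z else 0)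
  + (if (k < L)%N then rk_pred r k.+1 i else 0).

(* In both kinds of move, r' is determined on the triangle i <= k <= L by its
   interval multiplicities. *)
Definition connecting_move (c : nat) (l k i h : nat) r r' : Prop :=
  [/\ [/\ (l <= L)%N, (k.+1 <= l)%N, k.+1 = i & (h < i)%N],
      c%:Z <= omega r l i,
      c%:Z <= omega r k h
    & forall t u, (u <= t)%N -> (t <= L)%N ->
        omega r' t u =
          if (t, u) == (l, h) then omega r t u + c%:Z
          else if ((t, u) == (l, i)) || ((t, u) == (k, h))
          then omega r t u - c%:Z
          else omega r t u].

Definition swapping_move (c : nat) (l k i h : nat) r r' : Prop :=
  [/\ [/\ (l <= L)%N, (k < l)%N, (i <= k)%N & (h < i)%N],
      c%:Z <= omega r l i,
      c%:Z <= omega r k h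
    & forall t u, (u <= t)%N -> (t <= L)%N ->
        omega r' t u =
          if ((t, u) == (l, h)) || ((t, u) == (k, i))
          then omega r t u + c%:Z
          else if ((t, u) == (l, i)) || ((t, u) == (k, h))
          then omega r t u - c%:Z
          else omega r t u].

Definition rank_one_move r r' : Prop :=
  exists l k i h,
    connecting_move 1 l k i h r r' \/ swapping_move 1 l k i h r r'.

End AbstractMoves.

Inductive move_sequence (R : realType) (L : nat) (d : nat -> nat)
    (r s : nat -> nat -> nat) : Prop :=
| move_nil : valid_rank_list R L d r -> eq_rank_list L r s ->
    move_sequence R L d r s
| move_cons r' : valid_rank_list R L d r -> rank_one_move L r r' ->
    move_sequence R L d r' s -> move_sequence R L d r s.

(* Main.v *)
(* A move along (l, k, i, h) adds 1 to the ranks r_{t~u} in the rectangle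
   k < t <= l, h <= u < i and changes no other rank.  It is realised on every
   theta with rank list r by the perturbation W_{k+1} + c e phi, c <> 0, where
   e = W_{k+1~i} v for a vector v generating an interval [i, l], and the linear
   form phi is dual to an interval [h, k]; such v and phi exist because
   omega_{li} and omega_{kh} are positive.  The product mu changes only if
   (l, h) = (L, 0), so a move that keeps r_{L~0} degenerates inside the fiber:
   hence D implies A, and moves preserve validity.
   B implies C by lower semicontinuity of the rank.
   For C implies D, put delta = s - r and take the last column b in which delta
   is not zero, and the largest l with delta_{l~b} > 0; then omega_{l,b+1} > 0,
   which gives i = b + 1.  The other interval [h, k] is found by a staircase
   argument that goes left from column b. *)
Require Import Defs.
From mathcomp Require Import zify ring.

Set Implicit Arguments.
Unset Strict Implicit.
Unset Printing Implicit Defensive.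
Import Order.TTheory GRing.Theory Num.Theory.
Import numFieldNormedType.Exports.

Local Open Scope classical_set_scope.
Local Open Scope ring_scope.

(** * Moves as increments of the ranks on a rectangle *)

Definition in_rect (l k i h t u : nat) : bool :=
  (k < t <= l)%N && (h <= u < i)%N.

Lemma in_rectE l k i h t u :
  (in_rect l k i h t u)%:Z = (k < t <= l)%N%:Z * (h <= u < i)%N%:Z.
Proof. by rewrite -PoszM mulnb. Qed.

Lemma interval_indicator_succ k l t : (k < l)%N ->
  (k < t <= l)%N%:Z = (k < t.+1 <= l)%N%:Z + (t == l)%:Z - (t == k)%:Z.
Proof. by move=> kl; lia. Qed.

Lemma interval_indicator_pred h i u : (h < i)%N ->
  (h <= u < i)%N%:Z =
  (if u is u'.+1 then (h <= u' < i)%N%:Z else 0) + (u == h)%:Z - (u == i)%:Z.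
Proof. by move=> hi; case: u => [|u]; lia. Qed.

Lemma if_move_indicators (a b p q : bool) (x : int) :
  ~~ (a && b) -> ~~ (p && q) ->
  (if (a && p) || (b && q) then x + 1
   else if (a && q) || (b && p) then x - 1 else x) =
  x + (a && p)%:Z + (b && q)%:Z - (a && q)%:Z - (b && p)%:Z.
Proof.
by case: a; case: b; case: p; case: q => //= _ _; rewrite ?subr0 ?addr0.
Qed.

Section AbstractMoveRanks.
Variable L : nat.
Implicit Types r s : nat -> nat -> nat.

Definition adds_rect l k i h r r' : Prop :=
  forall t u, (u <= t)%N -> (t <= L)%N ->
    r' t u = (r t u + in_rect l k i h t u)%N.

(** [omega] is a mixed second difference, and the indicator of the rectangle is a product f(t) g(u)
    of interval indicators. Its mixed difference is (f(t) - f(t+1)) (g(u) - g(u-1)), which is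
    supported on the four corners. *)
Lemma omega_rectE r r' l k i h t u :
  (l <= L)%N -> (k < l)%N -> (h < i)%N -> (i <= k.+1)%N ->
  adds_rect l k i h r r' ->
  (u <= t)%N -> (t <= L)%N ->
  omega L r' t u = omega L r t u + ((t, u) == (l, h))%:Z + ((t, u) == (k, i))%:Z
    - ((t, u) == (l, i))%:Z - ((t, u) == (k, h))%:Z.
Proof.
move=> lL kl hi ik r'E ut tL.
have dt := interval_indicator_succ t kl.
have := interval_indicator_pred u hi.
(* [c] is g(u-1), set to 0 at u = 0 as in [rk_pred]. *)
set c : int := match u with 0 => _ | _ => _ end => du.
have pred t' : (u <= t')%N -> (t' <= L)%N ->
    rk_pred r' t' u = rk_pred r t' u + (k < t' <= l)%N%:Z * c.
  rewrite /c; case: u {ut du c} => [|u] ut t'L; first by rewrite mulr0 addr0.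
  by rewrite /= r'E ?PoszD ?in_rectE //; exact: ltnW.
have next : (if (t < L)%N then (r' t.+1 u)%:Z else 0) =
    (if (t < L)%N then (r t.+1 u)%:Z else 0)
    + (k < t.+1 <= l)%N%:Z * (h <= u < i)%N%:Z.
  (* For t = L the row t+1 is above l, so the boundary value 0 agrees with the indicator. *)
  case: ltnP => tL'; last first.
    by rewrite [(t < l)%N]ltnNge (leq_trans lL tL') andbF mul0r.
  by rewrite r'E ?PoszD ?in_rectE // leqW.
have nextpred : (if (t < L)%N then rk_pred r' t.+1 u else 0) =
    (if (t < L)%N then rk_pred r t.+1 u else 0) + (k < t.+1 <= l)%N%:Z * c.
  case: ltnP => tL'; last first.
    by rewrite [(t < l)%N]ltnNge (leq_trans lL tL') andbF mul0r.
  by rewrite pred // leqW.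
rewrite /omega next nextpred pred // r'E // PoszD in_rectE dt du.
rewrite !xpair_eqE -!mulnb !PoszM; ring.
Qed.

(** [omega] at (t, u) expresses r t u through entries closer to the corner (L, 0), hence the
    induction on L - t + u. *)
Lemma omega_inj r r' :
  (forall t u, (u <= t)%N -> (t <= L)%N -> omega L r t u = omega L r' t u) ->
  eq_rank_list L r r'.
Proof.
move=> rr'.
suff H n : forall t u, (u <= t)%N -> (t <= L)%N ->
    (L - t + u < n)%N -> r t u = r' t u.
  by move=> t u ut tL; apply: (H (L - t + u).+1).
elim: n => // n IH t u ut tL tun.
have := rr' t u ut tL; rewrite /omega /rk_pred.
case: u ut tun => [|u] ut tun; case: (ltnP t L) => tL'.
- by rewrite (IH t.+1 0%N); lia.
- by lia.
- by rewrite (IH t.+1 u.+1) ?(IH t.+1 u) ?(IH t u); lia.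
- by rewrite (IH t u); lia.
Qed.

(** Both kinds of move have one form: a connecting move is the case i = k+1, in which the corner (k,
    i) falls outside the triangle. *)
Lemma rank_one_moveP r r' : rank_one_move L r r' <->
  exists l k i h, [/\ [/\ (l <= L)%N, (k < l)%N, (h < i)%N & (i <= k.+1)%N],
   1 <= omega L r l i, 1 <= omega L r k h &
   adds_rect l k i h r r'].
Proof.
have disj (m n p : nat) : (m < n)%N -> ~~ ((p == n) && (p == m)).
  by move=> mn; apply: contraTN mn => /andP[/eqP-> /eqP->]; rewrite ltnn.
have disj' m n p : (m < n)%N -> ~~ ((p == m) && (p == n)).
  by rewrite andbC; exact: disj.
split=> [[l [k [i [h]]]] M|[l [k [i [h]]]] [[lL kl hi ik] oli okh r'E]].
  exists l, k, i, h.
  (* [q] and r' have the same multiplicities, so [omega_inj] identifies them. *)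
  pose q t u := (r t u + in_rect l k i h t u)%N.
  case: M => -[[lL kl ki hi] oli okh r'E].
    have ik : (i <= k.+1)%N by rewrite ki.
    split=> //; apply: omega_inj => t u ut tL.
    rewrite (@omega_rectE r q l k i h) // r'E // !xpair_eqE.
    have nki : (t == k) && (u == i) = false.
      by rewrite -ki; apply: contraTF ut => /andP[/eqP-> /eqP->]; rewrite ltnn.
    have := if_move_indicators (omega L r t u) (disj k l t kl) (disj' h i u hi).
    by rewrite nki orbF => ->.
  have ik : (i <= k.+1)%N := leqW ki.
  split=> //; apply: omega_inj => t u ut tL.
  rewrite (@omega_rectE r q l k i h) // r'E // !xpair_eqE.
  by rewrite (if_move_indicators _ (disj k l t kl) (disj' h i u hi)).
exists l, k, i, h.
have E := omega_rectE lL kl hi ik r'E.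
case: (leqP i k) => ki; [right|left]; split=> //.
  move=> t u ut tL; rewrite E // !xpair_eqE.
  by rewrite (if_move_indicators _ (disj k l t kl) (disj' h i u hi)).
  by split=> //; apply/eqP; rewrite eqn_leq ki.
move=> t u ut tL; rewrite E // !xpair_eqE.
have nki : (t == k) && (u == i) = false.
  by apply: contraTF ut => /andP[/eqP-> /eqP->]; rewrite -ltnNge.
have := if_move_indicators (omega L r t u) (disj k l t kl) (disj' h i u hi).
by rewrite nki orbF => <-.
Qed.

End AbstractMoveRanks.

(** * Combinatorics: a move from r that stays below s *)

Lemma last_run (P : pred nat) n l : (n < l)%N -> P l ->
  exists m, [/\ (n <= m)%N, (m < l)%N, m = n \/ ~~ P m &
    forall t, (m < t)%N -> (t <= l)%N -> P t].
Proof.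
elim: l => // l IH; rewrite ltnS leq_eqVlt => /predU1P[->|nl] Pl.
  exists l; split=> //; first by left.
  by move=> t lt tl; have -> : t = l.+1 by lia.
case: (boolP (P l)) => [/(IH nl)[m [nm ml mP mt]]|nPl].
  exists m; split=> //; first exact: leqW.
  move=> t mt'; rewrite leq_eqVlt => /predU1P[->//|]; exact: mt.
exists l; split=> //; [exact: ltnW|by right|].
by move=> t lt tl; have -> : t = l.+1 by lia.
Qed.

Section MoveExists.
Variables (L : nat) (r s : nat -> nat -> nat).
Hypothesis le_rs : le_rank_list L r s.
Hypothesis omega_s_ge0 : forall t u,
  (u <= t)%N -> (t <= L)%N -> 0 <= omega L s t u.

(* If no omega_{tu} with n <= t < l were positive, then subtracting column u - 1
   from column u of s - r would give a nonincreasing function of t on [n, l], so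
   the gap between rows n and l persists in column u - 1; it is contradictory in
   column -1, where s - r is 0. *)
Lemma staircase l b u n :
  (l <= L)%N -> (u <= b)%N -> (b <= n)%N -> (n < l)%N ->
  (forall t v, (n < t)%N -> (t <= l)%N -> (u <= v)%N -> (v <= b)%N ->
    (r t v < s t v)%N) ->
  (s n u - r n u < s l u - r l u)%N ->
  exists k h, [/\ (b <= k)%N, (k < l)%N, (h <= b)%N, 1 <= omega L r k h &
    forall t v, (k < t)%N -> (t <= l)%N -> (h <= v)%N -> (v <= b)%N ->
      (r t v < s t v)%N].
Proof.
move=> lL; elim: u n => [|u IH] n ub bn nl D sn.
  have [[t [nt tl ot]]|no] := pselect (exists t,
      [/\ (n <= t)%N, (t < l)%N & 1 <= omega L r t 0%N]).
    by exists t, 0%N; split=> //; [lia|move=> *; apply: D; lia].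
  have H t : (n <= t)%N -> (t <= l)%N ->
      (s t 0 - r t 0 <= s n 0 - r n 0)%N.
    elim: t => [|t IHt] nt tl; first by have -> : n = 0%N by lia.
    case: (ltnP t n) => tn; first by have -> : t.+1 = n by lia.
    apply: leq_trans (IHt _ _); [|lia|lia].
    have o : ~ (1 <= omega L r t 0%N) by move=> o; apply: no; exists t.
    have := @omega_s_ge0 t 0%N isT ltac:(lia).
    have := @le_rs t 0%N isT ltac:(lia); have := @le_rs t.+1 0%N isT ltac:(lia).
    by move: o; rewrite /omega /rk_pred (_ : (t < L)%N = true); lia.
  by have := H l ltac:(lia) ltac:(lia); lia.
have [[t [nt tl ot]]|no] := pselect (exists t,
    [/\ (n <= t)%N, (t < l)%N & 1 <= omega L r t u.+1]).
  by exists t, u.+1; split=> //; [lia|move=> *; apply: D; lia].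
pose f t : int := (s t u.+1)%:Z - (r t u.+1)%:Z - ((s t u)%:Z - (r t u)%:Z).
have H t : (n <= t)%N -> (t <= l)%N -> f t <= f n.
  elim: t => [|t IHt] nt tl; first by have -> : n = 0%N by lia.
  case: (ltnP t n) => tn; first by have -> : t.+1 = n by lia.
  apply: le_trans (IHt _ _); [|lia|lia].
  have o : ~ (1 <= omega L r t u.+1) by move=> o; apply: no; exists t.
  have := @omega_s_ge0 t u.+1 ltac:(lia) ltac:(lia).
  by move: o; rewrite /f /omega /rk_pred (_ : (t < L)%N = true); lia.
have {H} := H l ltac:(lia) ltac:(lia); rewrite /f => H.
have := @le_rs n u ltac:(lia) ltac:(lia) => le1.
have := @le_rs l u ltac:(lia) ltac:(lia) => le2.
have := @le_rs n u.+1 ltac:(lia) ltac:(lia) => le3.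
have := @le_rs l u.+1 ltac:(lia) ltac:(lia) => le4.
(* By [H], s - r is larger at row l than at row n in column u, so it is positive at l. On rows m+1
   to l of column u it stays positive; at m it is 0 unless m = n, so the gap between m and l
   persists. *)
have [m [nm ml mP mt]] :=
  @last_run (fun t => r t u < s t u)%N n l nl ltac:(lia).
apply: (IH m); [lia|lia|lia| |].
  move=> t v mt' tl uv vb; case: (eqVneq u v) => [<-|uv']; first exact: mt.
  by apply: D; lia.
by case: mP => [->|]; lia.
Qed.

(** Strict inequality on the whole rectangle keeps the result of the move below s. *)
Lemma move_exists :
  (forall j, (j <= L)%N -> r j j = s j j) -> ~ eq_rank_list L r s ->
  exists l k i h, [/\ [/\ (l <= L)%N, (k < l)%N, (h < i)%N & (i <= k.+1)%N],
   1 <= omega L r l i, 1 <= omega L r k h &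
   forall t u, (k < t)%N -> (t <= l)%N -> (h <= u)%N -> (u < i)%N ->
     (r t u < s t u)%N].
Proof.
move=> diag neq.
pose P b := `[< exists t, [/\ (b <= t)%N, (t <= L)%N & (r t b < s t b)%N] >].
have exP : exists b, P b.
  apply: contra_notP neq => nP t u ut tL; apply/eqP; rewrite eqn_leq le_rs //=.
  rewrite leqNgt; apply/negP => rs; apply: nP.
  by exists u; apply/asboolP; exists t.
have ubP b : P b -> (b <= L)%N by move=> /asboolP[t [? ? _]]; lia.
case: (ex_maxnP exP ubP) => b /asboolP[t0 [bt0 t0L Dt0]] bmax.
pose Q t := [&& b <= t, t <= L & r t b < s t b]%N.
have exQ : exists t, Q t by exists t0; apply/and3P.
have ubQ t : Q t -> (t <= L)%N by case/and3P.
case: (ex_maxnP exQ ubQ) => l /and3P[bl lL Dl] lmax.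
have {}bl : (b < l)%N.
  rewrite ltn_neqAle bl andbT; apply: contraTneq Dl => <-.
  by rewrite diag ?ltnn; lia.
have eqb t : (b < t)%N -> (t <= L)%N -> r t b.+1 = s t b.+1.
  move=> bt tL; apply/eqP; rewrite eqn_leq le_rs //= leqNgt; apply/negP => rs.
  suff /bmax : P b.+1 by rewrite ltnn.
  by apply/asboolP; exists t.
have [m [bm ml mP mt]] := @last_run (fun t => r t b < s t b)%N b l bl Dl.
(* Either m = b, on the diagonal, or the run of strict inequalities stops at m. *)
have Dm : r m b = s m b.
  have := @le_rs m b ltac:(lia) ltac:(lia).
  by case: mP => [->|]; [rewrite diag //; lia|lia].
have Drow t v : (m < t)%N -> (t <= l)%N -> (b <= v)%N -> (v <= b)%N ->
    (r t v < s t v)%N.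
  by move=> mt' tl bv vb; rewrite (_ : v = b) ?mt; lia.
have Dlt : (s m b - r m b < s l b - r l b)%N by rewrite Dm subnn subn_gt0.
have [k [h [bk kl hb o D]]] := staircase lL (leqnn _) bm ml Drow Dlt.
exists l, k, b.+1, h; split=> //.
(* Columns b+1 of r and s agree, and so do their entries (l+1, b) when l < L. So [omega] of r at (l,
   b+1) exceeds that of s, which is nonnegative, by s l b - r l b > 0. *)
have := @omega_s_ge0 l b.+1 bl lL.
rewrite /omega /rk_pred eqb //.
case: (ltnP l L) => lL'; last by lia.
have := @le_rs l.+1 b ltac:(lia) ltac:(lia).
have := lmax l.+1; rewrite ltnn /Q.
have := eqb l.+1 ltac:(lia) lL'.
lia.
Qed.

End MoveExists.

(** * Rank-one updates, and witnesses for strict Frobenius inequalities *)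

Section LinearAlgebra.
Variable F : fieldType.

Lemma mxrank_adds_row m n (A : 'M[F]_(m, n)) (y : 'rV[F]_n) :
  \rank (A + y)%MS = (\rank A + ~~ (y <= A)%MS)%N.
Proof.
have [yA|nyA] /= := boolP (y <= A)%MS; first by rewrite addn0 (addsmx_idPl yA).
apply/eqP; rewrite addn1 eqn_leq; apply/andP; split.
  rewrite (leq_trans (mxrank_adds_leqif _ _)) //.
  by have := rank_leq_row y; lia.
by rewrite ltn_neqAle (mxrank_leqif_sup (addsmxSl A y)) mxrankS ?addsmxSl //
  andbT addsmx_sub submx_refl.
Qed.

(* A column w with A w = 0 and y w = 1 gives (A + x y) w = x, so the column
   space of A + x y is spanned by x and the columns of A. *)
Lemma mxrank_rank_one_update m n
    (A : 'M[F]_(m, n)) (x : 'cV[F]_m) (y : 'rV[F]_n) :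
  ~~ (y <= A)%MS -> \rank (A + x *m y)%R = (\rank A + ~~ (x^T <= A^T)%MS)%N.
Proof.
move=> nyA.
have [w Aw yw] : exists2 w : 'cV[F]_n, A *m w = 0 & y *m w = 1%:M.
  move: nyA; rewrite submxE => /matrix0Pn[i [j]]; rewrite (ord1 i) => nz.
  set c := _ 0 j in nz; exists (col j (cokermx A) *m (c^-1)%:M).
    by rewrite mulmxA colE mulmxA -colE mulmx_coker col0 mul0mx.
  rewrite mulmxA colE mulmxA -colE; apply/matrixP => a b.
  by rewrite !ord1 mul_mx_scalar mxE [X in _ * X]mxE [RHS]mxE mulVf.
rewrite -mxrank_tr -(mxrank_tr A) -mxrank_adds_row.
apply: eqmx_rank.
have xE : x = (A + x *m y) *m w by rewrite mulmxDl Aw add0r -mulmxA yw mulmx1.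
have xA : (x^T <= (A + x *m y)^T)%MS by rewrite {1}xE trmx_mul submxMl.
apply/andP; split.
  rewrite linearD /= trmx_mul addmx_sub_adds //; exact: submxMl.
rewrite addsmx_sub xA andbT.
have -> : A^T = (A + x *m y)^T - y^T *m x^T.
  by rewrite -trmx_mul -linearB /= addrK.
by rewrite addmx_sub // eqmx_opp (submx_trans _ xA) // submxMl.
Qed.

(** By rank-nullity the hypothesis says that the kernel of C meets the row space of A B in a smaller
    dimension than that of B. So some row phi B killed by C is not in the row space of A B. *)
Lemma row_witness m n p q
    (A : 'M[F]_(m, n)) (B : 'M[F]_(n, p)) (C : 'M[F]_(p, q)) :
  (\rank (B *m C) + \rank (A *m B) < \rank B + \rank (A *m B *m C))%N ->
  exists phi : 'rV[F]_n, phi *m B *m C = 0 /\ ~~ (phi *m B <= A *m B)%MS.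
Proof.
rewrite -(mxrank_mul_ker B C) -(mxrank_mul_ker (A *m B) C) => lt.
have /row_subPn[i Bi] : ~~ (B :&: kermx C <= A *m B :&: kermx C)%MS.
  by apply: contraTN lt => /mxrankS; lia.
have /submxP[phi phiE] : (row i (B :&: kermx C)%MS <= B)%MS.
  exact: submx_trans (row_sub _ _) (capmxSl _ _).
have ki : (row i (B :&: kermx C)%MS <= kermx C)%MS.
  exact: submx_trans (row_sub _ _) (capmxSr _ _).
exists phi; rewrite -phiE; split; first exact/sub_kermxP.
by move: Bi; rewrite sub_capmx ki andbT.
Qed.

(** The hypothesis is invariant under transposition, which exchanges the roles of A and C. *)
Lemma col_witness m n p q
    (A : 'M[F]_(m, n)) (B : 'M[F]_(n, p)) (C : 'M[F]_(p, q)) :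
  (\rank (B *m C) + \rank (A *m B) < \rank B + \rank (A *m B *m C))%N ->
  exists v : 'cV[F]_p, A *m B *m v = 0 /\ ~~ ((B *m v)^T <= (B *m C)^T)%MS.
Proof.
move=> lt; have [|phi [phi0 nphi]] := @row_witness _ _ _ _ C^T B^T A^T.
  by rewrite -!trmx_mul !mxrank_tr mulmxA addnC.
exists phi^T; split.
  by apply: trmx_inj; rewrite !trmx_mul trmxK trmx0 mulmxA.
by rewrite !trmx_mul trmxK.
Qed.

End LinearAlgebra.

(** * Interval multiplicities as Frobenius defects of subproducts *)

Section Subprod.
Variables (R : realType) (L : nat) (d : nat -> nat).
Implicit Types (theta : weight_space R L d) (r s : nat -> nat -> nat).

Lemma layerE theta j (jL : (j < L)%N) : layer theta j = theta (Ordinal jL).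
Proof.
rewrite /layer; case: {-}_ / idP => [jL'|//].
by rewrite (bool_irrelevance jL' jL).
Qed.

Lemma subprod_comp theta t m u : (u <= m)%N -> (m <= t)%N ->
  subprod theta t u = subprod theta t m *m subprod theta m u.
Proof.
move=> um; elim: t => [|t IH].
  by rewrite leqn0 => /eqP ->; rewrite subprod_id mul1mx.
rewrite leq_eqVlt => /predU1P[<-|]; first by rewrite subprod_id mul1mx.
rewrite ltnS => mt; rewrite !subprodS // ?IH ?mulmxA //; exact: leq_trans mt.
Qed.

(* A stands for W_{t+1} and C for W_u; they are 0 if t = L, resp. u = 0. *)
Lemma omegaE theta r t u : has_rank_list theta r -> (u <= t)%N -> (t <= L)%N ->
  exists p q (A : 'M[R]_(p, d t)) (C : 'M[R]_(d u, q)),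
  let B := subprod theta t u in
  [/\ omega L r t u = (\rank B)%:Z - (\rank (B *m C))%:Z - (\rank (A *m B))%:Z
        + (\rank (A *m B *m C))%:Z,
      forall t', (t < t')%N -> (t' <= L)%N ->
        exists X, subprod theta t' t = X *m A
    & forall u', (u' < u)%N -> exists Y, subprod theta u u' = C *m Y].
Proof.
move=> rP ut tL.
pose A : 'M[R]_(d t.+1, d t) := if (t < L)%N then layer theta t else 0.
have [q [C [CP CE]]] : exists q (C : 'M[R]_(d u, q)),
    (forall u', (u' < u)%N -> exists Y, subprod theta u u' = C *m Y) /\
    forall k, (u <= k)%N -> (k <= L)%N ->
      (\rank (subprod theta k u *m C))%:Z = rk_pred r k u.
  case: u ut => [|u] ut.
    by exists 0%N, 0; split=> // *; rewrite mulmx0 mxrank0.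
  exists (d u), (subprod theta u.+1 u); split.
    move=> u' u'u; exists (subprod theta u u').
    by apply: subprod_comp => //; exact: leqnSn.
  move=> k uk kL; rewrite -subprod_comp //= ?rP //; lia.
exists (d t.+1), q, A, C; split=> //; last first.
  move=> t' tt' t'L; exists (subprod theta t' t.+1).
  rewrite /A (leq_trans tt') //.
  by rewrite (@subprod_comp _ _ t.+1) // subprodS // subprod_id mulmx1.
rewrite /omega CE // rP // /A; case: ltnP => tL'; last first.
  by rewrite !mul0mx !mxrank0; lia.
by rewrite -subprodS // CE ?rP //; lia.
Qed.

(** This is the Frobenius rank inequality for A B C. *)
Lemma omega_ge0 r t u : valid_rank_list R L d r -> (u <= t)%N -> (t <= L)%N ->
  0 <= omega L r t u.
Proof.
move=> [theta rP] ut tL.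
have [p [q [A [C [-> _ _]]]]] := omegaE rP ut tL.
set B := subprod theta t u.
have : (\rank (A *m B) + \rank (B *m C) <= \rank B + \rank (A *m B *m C))%N.
  exact: mxrank_Frobenius.
lia.
Qed.

End Subprod.

(** * Realising a move by a rank-one perturbation of one layer *)

Section Perturbation.
Variables (R : realType) (L : nat) (d : nat -> nat).
Implicit Types (theta : weight_space R L d) (r s : nat -> nat -> nat).

(** The vector v of [col_witness] is killed beyond layer l since A B v = 0. For i <= u its image
    factors through W_{t~u}. For u < i, membership in the image of W_{t~u} would, after applying
    W_{l~t}, put B v in the image of B C. Transposes appear because [<=] compares row spaces. *)
Lemma col_direction theta r l k i : has_rank_list theta r ->
  (l <= L)%N -> (k < l)%N -> (i <= k.+1)%N -> 1 <= omega L r l i ->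
  exists e : 'cV[R]_(d k.+1),
  [/\ forall t, (l < t)%N -> (t <= L)%N -> subprod theta t k.+1 *m e = 0
    & forall t u, (k < t)%N -> (t <= l)%N -> (u <= k)%N ->
      ((subprod theta t k.+1 *m e)^T <= (subprod theta t u)^T)%MS = (i <= u)%N].
Proof.
move=> rP lL kl ik.
have [p [q [A [C [-> AP CP]]]]] := omegaE rP (leq_trans ik kl) lL.
set B := subprod theta l i => o.
have lt : (\rank (B *m C) + \rank (A *m B)
    < \rank B + \rank (A *m B *m C))%N by lia.
have [v [v0 nv]] := col_witness lt.
exists (subprod theta k.+1 i *m v); split=> [t lt' tL|t u kt tl uk].
  have [X XE] := AP t lt' tL.
  rewrite mulmxA -subprod_comp //; last lia.
  rewrite (@subprod_comp _ _ _ _ _ l) ?XE; [|lia|lia].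
  by rewrite -!mulmxA (mulmxA A) v0 mulmx0.
rewrite mulmxA -subprod_comp //.
case: (leqP i u) => [iu|ui].
  rewrite (@subprod_comp _ _ _ _ t u i) //; last lia.
  by rewrite -mulmxA trmx_mul submxMl.
apply: contraNF nv => /submxP[D DE].
have [Y YE] := CP u ui.
have -> : B *m v = subprod theta l t *m (subprod theta t i *m v).
  by rewrite mulmxA -subprod_comp //; lia.
rewrite trmx_mul DE -mulmxA -trmx_mul -subprod_comp //; last lia.
rewrite (@subprod_comp _ _ _ _ l i u) //; [|lia|lia].
by rewrite YE mulmxA trmx_mul mulmxA submxMl.
Qed.

(** Dual argument: phi B C = 0 kills the columns u < h, and membership in the row space of W_{t~u},
    multiplied on the right by W_{u~h}, would put phi B in the row space of A B. *)
Lemma row_direction theta r k h : has_rank_list theta r ->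
  (k <= L)%N -> (h <= k)%N -> 1 <= omega L r k h ->
  exists phi : 'rV[R]_(d k),
  [/\ forall u, (u < h)%N -> phi *m subprod theta k u = 0
    & forall t u, (k < t)%N -> (t <= L)%N -> (h <= u)%N -> (u <= k)%N ->
      ~~ (phi *m subprod theta k u <= subprod theta t u)%MS].
Proof.
move=> rP kL hk.
have [p [q [A [C [-> AP CP]]]]] := omegaE rP hk kL.
set B := subprod theta k h => o.
have lt : (\rank (B *m C) + \rank (A *m B)
    < \rank B + \rank (A *m B *m C))%N by lia.
have [phi [phi0 nphi]] := row_witness lt.
exists phi; split=> [u uh|t u kt tL hu uk].
  have [Y YE] := CP u uh.
  by rewrite (@subprod_comp _ _ _ _ _ h) ?YE ?mulmxA ?phi0 ?mul0mx //; lia.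
apply: contra nphi => /submxP[D DE].
have [X XE] := AP t kt tL.
have -> : phi *m B = phi *m subprod theta k u *m subprod theta u h.
  by rewrite -mulmxA -subprod_comp.
rewrite DE -mulmxA -subprod_comp //; last lia.
rewrite (@subprod_comp _ _ _ _ t k h) //; last lia.
by rewrite XE -mulmxA (mulmxA D) submxMl.
Qed.

Definition add_layer theta k (kL : (k < L)%N) (N : 'M[R]_(d k.+1, d k)) :
    weight_space R L d :=
  dfwith theta (Ordinal kL) (theta (Ordinal kL) + N).

Section AddLayer.
Variables (theta : weight_space R L d) (k : nat) (kL : (k < L)%N).
Variable N : 'M[R]_(d k.+1, d k).
Local Notation theta' := (add_layer theta kL N).

Lemma layer_add_layer_eq : layer theta' k = layer theta k + N.
Proof. by rewrite !(layerE _ kL) /add_layer dfwithin. Qed.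

Lemma layer_add_layer_neq j : j != k -> layer theta' j = layer theta j.
Proof.
move=> jk; case: (ltnP j L) => jL; last first.
  by rewrite /layer; case: {-}_ / idP => // jL'; lia.
by rewrite !(layerE _ jL) /add_layer dfwithout // eq_sym.
Qed.

Lemma subprod_add_layer_out t u : (u <= t)%N -> (t <= k)%N || (k < u)%N ->
  subprod theta' t u = subprod theta t u.
Proof.
elim: t => [|t IH]; first by rewrite leqn0 => /eqP ->; rewrite !subprod_id.
rewrite leq_eqVlt => /predU1P[->|ut] tk; first by rewrite !subprod_id.
rewrite !subprodS // IH ?layer_add_layer_neq //; lia.
Qed.

Lemma subprod_add_layer_in t u : (u <= k)%N -> (k < t)%N ->
  subprod theta' t u =
  subprod theta t u + subprod theta t k.+1 *m N *m subprod theta k u.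
Proof.
move=> uk kt; rewrite (@subprod_comp _ _ _ _ t k.+1) //; last lia.
rewrite subprod_add_layer_out ?ltnSn ?orbT // subprodS // layer_add_layer_eq.
rewrite subprod_add_layer_out ?leqnn // mulmxDl mulmxDr -subprodS // mulmxA.
by rewrite -subprod_comp //; lia.
Qed.

End AddLayer.

(** [N] is chosen before c, so that c can tend to 0 along a line. The row factor never lies in the
    old row space when h <= u, so inside t <= l the rank grows exactly when the column factor is
    new, that is, when u < i. *)
Lemma move_perturbation theta r r' l k i h (kL : (k < L)%N) :
  has_rank_list theta r ->
  (l <= L)%N -> (k < l)%N -> (h < i)%N -> (i <= k.+1)%N ->
  1 <= omega L r l i -> 1 <= omega L r k h ->
  adds_rect L l k i h r r' ->
  exists N : 'M[R]_(d k.+1, d k), forall c : R, c != 0 ->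
    has_rank_list (add_layer theta kL (c *: N)) r' /\
    (r' L 0%N = r L 0%N -> mu L d (add_layer theta kL (c *: N)) = mu L d theta).
Proof.
move=> rP lL kl hi ik oli okh r'E.
have [e [e0 eE]] := col_direction rP lL kl ik oli.
have [phi [phi0 nphi]] := row_direction rP (ltnW kL) (leq_trans hi ik) okh.
exists (e *m phi) => c c0.
(* The scalar sits on the row factor, whose span a nonzero c does not change. *)
have inE t u : (u <= k)%N -> (k < t)%N ->
  subprod (add_layer theta kL (c *: (e *m phi))) t u =
  subprod theta t u
    + (subprod theta t k.+1 *m e) *m (c *: (phi *m subprod theta k u)).
  move=> uk kt; rewrite subprod_add_layer_in //.
  by rewrite -!(scalemxAl, scalemxAr) !mulmxA.
split.
  move=> t u ut tL; rewrite r'E //.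
  case: (boolP ((t <= k) || (k < u)))%N => [out|].
    by rewrite subprod_add_layer_out // rP // /in_rect; lia.
  rewrite negb_or -ltnNge -leqNgt => /andP[kt uk].
  rewrite inE //.
  case: (leqP t l) => tl; last first.
    by rewrite e0 // mul0mx addr0 rP // /in_rect; lia.
  case: (leqP h u) => hu; last first.
    by rewrite phi0 // scaler0 mulmx0 addr0 rP // /in_rect; lia.
  rewrite mxrank_rank_one_update; last by rewrite eqmx_scale // nphi.
  by rewrite eE // rP // /in_rect; lia.
rewrite r'E // /mu inE // /in_rect.
case: (eqVneq l L) => [->|lL']; last by rewrite e0 ?mul0mx ?addr0 //; lia.
case: (posnP h) => [->|h0]; last by rewrite phi0 // scaler0 mulmx0 addr0.
(* Here (l, h) = (L, 0), and the corner (L, 0) lies in the rectangle, against r' L 0 = r L 0. *)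
lia.
Qed.

End Perturbation.

(** * Lower semicontinuity of the rank *)

Section EntrywiseConvergence.
Variables (R : realType) (T : Type) (F : set_system T).
Context {FF : Filter F}.

Definition entries_cvg m n (M : T -> 'M[R]_(m, n)) (A : 'M[R]_(m, n)) :=
  forall i j, M x i j @[x --> F] --> A i j.

Lemma entries_cvg_cst m n (A : 'M[R]_(m, n)) : entries_cvg (fun=> A) A.
Proof. by move=> i j; exact: cvg_cst. Qed.

Lemma entries_cvg_mul m n p
    (M : T -> 'M[R]_(m, n)) A (N : T -> 'M[R]_(n, p)) B :
  entries_cvg M A -> entries_cvg N B ->
  entries_cvg (fun x => M x *m N x) (A *m B).
Proof.
move=> MA NB i j; rewrite mxE; under eq_cvg do rewrite mxE.
by apply: cvg_big => [|k _]; [exact: add_continuous|apply: cvgM].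
Qed.

Lemma entries_cvg_det n (M : T -> 'M[R]_n) A :
  entries_cvg M A -> \det (M x) @[x --> F] --> \det A.
Proof.
move=> MA; apply: cvg_big => [|s _]; first exact: add_continuous.
apply: cvgM; first exact: cvg_cst.
by apply: cvg_big => [|i _]; [exact: mul_continuous|exact: MA].
Qed.

(** Fixed [P] and [Q] reduce A to an identity matrix of size rk A. The determinant of P M(x) Q tends
    to 1, so this product is eventually invertible and bounds the rank of M(x) from below. *)
Lemma near_mxrank_ge m n (M : T -> 'M[R]_(m, n)) A :
  entries_cvg M A -> \forall x \near F, (\rank A <= \rank (M x))%N.
Proof.
move=> MA; set q := \rank A.
pose P : 'M[R]_(q, m) := pid_mx q *m invmx (col_ebase A).
pose Q : 'M[R]_(n, q) := invmx (row_ebase A) *m pid_mx q.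
have PAQ : P *m A *m Q = 1%:M.
  rewrite /P /Q -{2}(mulmx_ebase A) -!mulmxA mulKmx ?col_ebase_unit //.
  rewrite mulKVmx ?row_ebase_unit // mulmxA !mul_pid_mx.
  have qm : (q <= m)%N := rank_leq_row A.
  have qn : (q <= n)%N := rank_leq_col A.
  by rewrite (_ : minn _ _ = q) ?pid_mx_1 //; lia.
have cvgdet : \det (P *m M x *m Q) @[x --> F] --> (1 : R).
  rewrite -(det1 R q) -PAQ; apply: entries_cvg_det.
  apply: entries_cvg_mul; last exact: entries_cvg_cst.
  by apply: entries_cvg_mul => //; exact: entries_cvg_cst.
near=> x.
have nz : \det (P *m M x *m Q) != 0.
  by near: x; apply: cvgr_neq0 cvgdet (oner_neq0 _).
have U : P *m M x *m Q \in unitmx by rewrite unitmxE unitfE.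
rewrite -(mxrank_unit U) (leq_trans (mxrankM_maxl _ _)) //; exact: mxrankM_maxr.
Unshelve. all: by end_near. Qed.

End EntrywiseConvergence.

(** * Strata: closures and nonemptiness *)

Section Strata.
Variables (R : realType) (L : nat) (d : nat -> nat).
Implicit Types (theta : weight_space R L d) (r s : nat -> nat -> nat).

Lemma subprod_cvg theta k i : (i <= k)%N ->
  @entries_cvg R _ (nbhs theta) _ _
    (fun theta' : weight_space R L d => subprod theta' k i) (subprod theta k i).
Proof.
elim: k => [|k IH]; first by move=> _; exact: entries_cvg_cst.
rewrite leq_eqVlt => /predU1P[->|ik].
  rewrite subprod_id.
  under [X in entries_cvg _ X _]eq_fun do rewrite subprod_id.
  exact: entries_cvg_cst.
rewrite subprodS //.
under [X in entries_cvg _ X _]eq_fun do rewrite subprodS //.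
apply: entries_cvg_mul; last exact: IH.
case: (ltnP k L) => kL; last first.
  rewrite /layer; case: {-}_ / idP; [lia|move=> _]; exact: entries_cvg_cst.
rewrite layerE; under [X in entries_cvg _ X _]eq_fun do rewrite layerE.
move=> a b.
apply: (@cvg_comp _ _ _
    (fun theta' : weight_space R L d => theta' (Ordinal kL))
    (fun M => M a b) _ (nbhs (theta (Ordinal kL)))).
  exact: (@proj_continuous _ (fun j : 'I_L => 'M[R]_(d j.+1, d j))).
exact: coord_continuous.
Qed.

Lemma closure_le_rank_list (W : 'M[R]_(d L, d 0%N)) r s :
  stratum L d W r `&` closure (stratum L d W s) !=set0 -> le_rank_list L r s.
Proof.
move=> [theta [[_ thr] cl]] k i ik kL.
(* The neighbourhood of theta on which this rank does not drop meets the stratum of s. *)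
have [theta' [[_ ths]]] := cl _ (near_mxrank_ge (@subprod_cvg theta k i ik)).
by rewrite /= thr // ths.
Qed.

(** Matrices of equal rank are equivalent, so W = P mu(theta) Q with P and Q invertible. Changing
    bases at the two end layers moves theta into the fiber of W and preserves all ranks. *)
Lemma stratum_nonempty (W : 'M[R]_(d L, d 0%N)) r : (0 < L)%N ->
  valid_rank_list R L d r -> \rank W = r L 0%N -> stratum L d W r !=set0.
Proof.
move=> L0 [theta thr] rkW.
have rk : \rank (mu L d theta) = \rank W by rewrite rkW -thr.
pose P := col_ebase W *m invmx (col_ebase (mu L d theta)).
pose Q := invmx (row_ebase (mu L d theta)) *m row_ebase W.
(* Since 0 < L, the base changes at 0 and L do not collide. *)
pose G := dfwith (dfwith (fun j => 1%:M : 'M[R]_(d j)) 0%N (invmx Q)) L P.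
have GL : G L = P by rewrite /G dfwithin.
have G0 : G 0%N = invmx Q by rewrite /G dfwithout ?dfwithin //; lia.
have Gu j : G j \in unitmx.
  rewrite /G; case: dfwithP => [|{}j _]; last first.
    case: dfwithP => [|{}j _]; last exact: unitmx1.
    by rewrite unitmx_inv unitmx_mul unitmx_inv !row_ebase_unit.
  by rewrite unitmx_mul col_ebase_unit unitmx_inv col_ebase_unit.
pose theta' : weight_space R L d :=
  fun j : 'I_L => G j.+1 *m theta j *m invmx (G j).
have sE k i : (i <= k)%N -> (k <= L)%N ->
    subprod theta' k i = G k *m subprod theta k i *m invmx (G i).
  elim: k => [|k IH].
    by rewrite leqn0 => /eqP -> _; rewrite !subprod_id mulmx1 mulmxV.
  rewrite leq_eqVlt => /predU1P[->|ik] kL.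
    by rewrite !subprod_id mulmx1 mulmxV.
  rewrite !subprodS // IH //; last exact: ltnW.
  by rewrite !(layerE _ kL) /theta' -!mulmxA mulKmx.
exists theta'; split.
  rewrite /fiber /= /mu sE // GL G0 invmxK.
  rewrite -/(mu L d theta) -(mulmx_ebase (mu L d theta)) rk.
  rewrite /P /Q -!mulmxA mulKmx ?col_ebase_unit //.
  by rewrite mulKVmx ?row_ebase_unit // mulmxA mulmx_ebase.
move=> k i ik kL; rewrite sE // -thr //.
rewrite mxrankMfree ?row_free_unit ?unitmx_inv //.
rewrite -mxrank_tr trmx_mul mxrankMfree ?mxrank_tr //.
by rewrite row_free_unit unitmx_tr.
Qed.

Lemma add_layer_closure theta k (kL : (k < L)%N) (N : 'M[R]_(d k.+1, d k))
    (S : set (weight_space R L d)) :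
  (forall c, c != 0 -> S (add_layer theta kL (c *: N))) -> closure S theta.
Proof.
move=> H U nU.
have f0 : dfwith theta (Ordinal kL) (theta (Ordinal kL)) = theta.
  by apply: functional_extensionality_dep => j; case: dfwithP.
have := @dfwith_continuous _ (fun j : 'I_L => 'M[R]_(d j.+1, d j)) theta
  (Ordinal kL) (theta (Ordinal kL)) U.
rewrite f0 => /(_ nU)[P nP PU].
(* [P] gives one neighbourhood per entry. Finitely many conditions on c result, each true near 0. *)
pose f (ij : 'I_(d k.+1) * 'I_(d k)) : set R :=
  [set c | P ij.1 ij.2 (theta (Ordinal kL) ij.1 ij.2 + c * N ij.1 ij.2)].
have : \forall c \near nbhs (0 : R), forall ij, f ij c.
  apply: filter_forall => -[i j].
  have : theta (Ordinal kL) i j + c * N i j @[c --> (0 : R)]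
      --> theta (Ordinal kL) i j + 0 * N i j.
    apply: cvgD; first exact: cvg_cst.
    by apply: cvgM; [exact: cvg_id|exact: cvg_cst].
  rewrite mul0r addr0 => /(_ _ (nP i j)); exact.
move=> /nbhs_dnbhs near0.
(* Punctured neighbourhoods of 0 in R are nonempty, which supplies a nonzero c. *)
have [c [c0 Pc]] := @filter_ex _ _ _ _
  (filterI (F := (0 : R)^') (nbhs_dnbhs_neq (0 : R)) near0).
exists (add_layer theta kL (c *: N)); split; first exact: H.
by apply: PU => i j; rewrite !mxE; exact: Pc (i, j).
Qed.

End Strata.

(** * Sequences of moves *)

Section MoveSequences.
Variables (R : realType) (L : nat) (d : nat -> nat).
Implicit Types (r s : nat -> nat -> nat) (W : 'M[R]_(d L, d 0%N)).

Lemma rank_one_move_le r r' : rank_one_move L r r' -> le_rank_list L r r'.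
Proof.
move=> /rank_one_moveP[l [k [i [h [_ _ _ r'E]]]]] t u ut tL.
by rewrite r'E // leq_addr.
Qed.

Lemma rank_one_move_valid r r' :
  valid_rank_list R L d r -> rank_one_move L r r' -> valid_rank_list R L d r'.
Proof.
move=> [theta thr] /rank_one_moveP[l [k [i [h [[lL kl hi ik] oli okh r'E]]]]].
have [N /(_ 1 (oner_neq0 _))[thr' _]] :=
  move_perturbation (leq_trans kl lL) thr lL kl hi ik oli okh r'E.
by exists (add_layer theta (leq_trans kl lL) (1 *: N)).
Qed.

Lemma rank_one_move_closure W r r' : rank_one_move L r r' ->
  r' L 0%N = r L 0%N -> stratum L d W r `<=` closure (stratum L d W r').
Proof.
move=> /rank_one_moveP[l [k [i [h [[lL kl hi ik] oli okh r'E]]]]] rr'.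
move=> theta [thW thr].
have [N NP] := move_perturbation (leq_trans kl lL) thr lL kl hi ik oli okh r'E.
apply: (@add_layer_closure _ _ _ _ _ (leq_trans kl lL) N) => c /NP[thr' thmu].
by split=> //; rewrite /fiber /= thmu.
Qed.

Lemma move_sequence_le r s : move_sequence R L d r s -> le_rank_list L r s.
Proof.
elim=> {r s} [r s _ rs|r s r' _ rr' _ r's] k i ik kL; first by rewrite rs.
exact: leq_trans (rank_one_move_le rr' ik kL) (r's k i ik kL).
Qed.

Lemma move_sequence_closure W r s :
  move_sequence R L d r s -> r L 0%N = s L 0%N ->
  stratum L d W r `<=` closure (stratum L d W s).
Proof.
elim=> {r s} [r s _ rs|r s r' _ rr' r's IH] rs0.
  move=> theta [thW thr]; apply: subset_closure; split=> // k i ik kL.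
  by rewrite thr // rs.
(* Moves only increase ranks, so r' L 0 is squeezed between the equal values r L 0 and s L 0, and
   every intermediate stratum lies in the same fiber. *)
have := rank_one_move_le rr' (leq0n L) (leqnn L).
have := move_sequence_le r's (leq0n L) (leqnn L).
rewrite -rs0 => le1 le2.
have r'0 : r' L 0%N = r L 0%N by apply/eqP; rewrite eqn_leq le1.
apply: subset_trans (rank_one_move_closure rr' r'0) _.
rewrite [X in _ `<=` X](closure_id _).1; last exact: closed_closure.
by apply: closure_subset; apply: IH; rewrite r'0.
Qed.

(** Induction on the sum of s - r over the triangle; each move from [move_exists] lowers it and
    stays below s. *)
Lemma le_move_sequence r s :
  valid_rank_list R L d r -> valid_rank_list R L d s ->
  le_rank_list L r s -> move_sequence R L d r s.
Proof.
move=> rV sV.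
pose gap r := (\sum_(p : 'I_L.+1 * 'I_L.+1 | p.2 <= p.1)
                 (s p.1 p.2 - r p.1 p.2))%N.
have [n] := ubnP (gap r); elim: n r rV => // n IH r rV gapn rs.
have [rsE|rs_neq] := pselect (eq_rank_list L r s); first exact: move_nil.
have diag j : (j <= L)%N -> r j j = s j j.
  by move=> jL; rewrite (valid_rank_list_diag rV) ?(valid_rank_list_diag sV).
have [l [k [i [h [[lL kl hi ik] oli okh D]]]]] :=
  move_exists rs (fun t u => omega_ge0 sV) diag rs_neq.
pose r' t u := (r t u + in_rect l k i h t u)%N.
have rr' : rank_one_move L r r' by apply/rank_one_moveP; exists l, k, i, h.
apply: (move_cons rV rr'); apply: IH; first exact: rank_one_move_valid rr'.
- apply: (@leq_trans (gap r)) => //.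
  have lh : (h <= l)%N by lia.
  have lL1 : (l < L.+1)%N by lia.
  have hL1 : (h < L.+1)%N by lia.
  (* The corner (l, h) belongs to the rectangle, so its term drops strictly. *)
  rewrite /gap (bigD1 (Ordinal lL1, Ordinal hL1)) //=.
  rewrite [ltnRHS](bigD1 (Ordinal lL1, Ordinal hL1)) //= -addSn leq_add //.
    have := D l h; rewrite /r' /in_rect; lia.
  by apply: leq_sum => p _; rewrite /r' leq_sub2l // leq_addr.
- move=> t u ut tL; rewrite /r' /in_rect.
  case: andP => [[/andP[? ?] /andP[? ?]]|_].
    by rewrite addn1; exact: D.
  by rewrite addn0 rs.
Qed.

End MoveSequences.

Theorem theorem27 (R : realType) (L : nat) (d : nat -> nat)
    (L_gt0 : (0 < L)%N) (d_gt0 : forall j : nat, (j <= L)%N -> (0 < d j)%N)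
    (r s : nat -> nat -> nat)
    (r_valid : valid_rank_list R L d r) (s_valid : valid_rank_list R L d s)
    (W : 'M[R]_(d L, d 0%N))
    (rkW_r : \rank W = r L 0%N) (rkW_s : \rank W = s L 0%N) :
  (stratum L d W r !=set0 /\ stratum L d W s !=set0) /\
  [<-> stratum L d W r `<=` closure (stratum L d W s);
       stratum L d W r `&` closure (stratum L d W s) !=set0;
       le_rank_list L r s;
       move_sequence R L d r s].
Proof.
(* Nonemptiness of the stratum of r also yields the step from A to B. *)
have Sr := stratum_nonempty L_gt0 r_valid rkW_r.
split; first by split=> //; exact: stratum_nonempty.
tfae.
- by move=> sub; have [theta th] := Sr; exists theta; split=> //; exact: sub.
- exact: closure_le_rank_list.
- exact: le_move_sequence.
- by move=> rs; apply: move_sequence_closure; rewrite // -rkW_r -rkW_s.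
Qed.
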